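(* Let $q\in\mathbb{C}$ with $0<|q|<1$, let $a,b,c,z\in\mathbb{C}\setminus\{0\}$ with $\frac1{ab},\frac1{ac}\notin\Omega_q$, and let $x=\frac12(z+z^{-1})$. Then as $n\to\infty$, $$p_n(x;a,b,c|q^{-1})\sim q^{-2\binom n2}(abc)^n\left(\tfrac1{ab},\tfrac1{ac};q\right)_\infty\;{}_2\phi_2\!\left(\begin{array}{c}\frac za,\frac1{az}\\ \frac1{ab},\frac1{ac}\end{array};q,\frac1{bc}\right),$$ with an error term of order $\mathcal{O}\!\left(\frac{|q|^{-2\binom n2}|abc|^n}{n}\right)$; that is, the difference between the left-hand side and the right-hand side is $\mathcal{O}\!\left(\frac{|q|^{-2\binom n2}|abc|^n}{n}\right)$ as $n\to\infty$.
   Context: Notation: $(A;p)_n=\prod_{j=0}^{n-1}(1-Ap^j)$ for $p\in\mathbb{C}\setminus\{0\}$; $(A;q)_\infty=\prod_{j\ge0}(1-Aq^j)$; $(A_1,\dots,A_k;p)_n=\prod_i(A_i;p)_n$. $\Omega_q=\{q^{-k}:k=0,1,2,\dots\}$, $\binom n2=\frac{n(n-1)}2$. ${}_2\phi_2(a_1,a_2;b_1,b_2;q,w)=\sum_{k\ge0}\frac{(a_1,a_2;q)_k}{(q,b_1,b_2;q)_k}(-1)^kq^{\binom k2}w^k$ (entire in $w$). Continuous dual Hahn polynomials: for a base $p\in\mathbb{C}\setminus\{0\}$, $|p|\neq1$, $a\ne0$, $x=\frac12(z+z^{-1})$, $$p_n(x;a,b,c|p)=a^{-n}\sum_{k=0}^n\frac{(p^{-n},az,az^{-1};p)_k\,(abp^k,acp^k;p)_{n-k}}{(p;p)_k}\,p^k,$$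 which equals $a^{-n}(ab,ac;p)_n\,{}_3\phi_2(p^{-n},az,az^{-1};ab,ac;p,p)$ when the latter is defined. The continuous dual $q^{-1}$-Hahn polynomials are $p_n(x;a,b,c|q^{-1})$, i.e. $p=q^{-1}$. *)

(* Defs.v *)
From Stdlib Require Import Reals Lra.
From Coquelicot Require Import Coquelicot.
Open Scope C_scope.

Definition binom2 (n : nat) : nat := Nat.div (n * (n - 1)) 2.

(* (A;p)_n *)
Fixpoint qpoch (A p : C) (n : nat) : C :=
  match n with
  | O => 1
  | S m => qpoch A p m * (1 - A * p ^ m)
  end.

(* (A;q)_oo.  The [iota] of a limit is that limit when it exists (here, when
   |q| < 1) and is unspecified otherwise. *)
Definition qpoch_inf (A q : C) : C :=
  @iota C_CompleteNormedModule
    (fun l : C => filterlim (qpoch A q) eventually (locally l)).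

(* The set {q^(-k) : k = 0, 1, 2, ...}. *)
Definition Omega (q w : C) : Prop := exists k : nat, w = / q ^ k.

Definition phi22_term (a1 a2 b1 b2 q w : C) (k : nat) : C :=
  (qpoch a1 q k * qpoch a2 q k) / (qpoch q q k * qpoch b1 q k * qpoch b2 q k)
  * (-1) ^ k * q ^ binom2 k * w ^ k.

Definition phi22 (a1 a2 b1 b2 q w : C) : C :=
  @iota C_CompleteNormedModule
    (fun l : C => @is_series C_AbsRing C_NormedModule
                    (phi22_term a1 a2 b1 b2 q w) l).

(* The defining sum of the continuous dual Hahn polynomial to the base p,
   in terms of z, where x = (z + 1/z)/2; [sum_n f n] is f 0 + ... + f n. *)
Definition cdHahn_z (n : nat) (z a b c p : C) : C :=
  / a ^ n *
  @sum_n C_AbelianMonoid (fun k : nat =>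
    (qpoch (/ p ^ n) p k * qpoch (a * z) p k * qpoch (a * / z) p k)
    * (qpoch (a * b * p ^ k) p (n - k) * qpoch (a * c * p ^ k) p (n - k))
    / qpoch p p k * p ^ k) n.

(* p_n(x;a,b,c|p): the common value of the above over all z <> 0 such that
   x = (z + 1/z)/2, see [cdHahnE]. *)
Definition cdHahn (n : nat) (x a b c p : C) : C :=
  @iota C_CompleteNormedModule
    (fun w : C => forall z : C, z <> 0 -> x = (z + / z) / 2 ->
                  w = cdHahn_z n z a b c p).

Lemma cdHahn_z_inv (n : nat) (z a b c p : C) :
  z <> 0 -> cdHahn_z n (/ z) a b c p = cdHahn_z n z a b c p.
Proof.
intros Hz; unfold cdHahn_z; f_equal; apply sum_n_ext; intros k.
replace (/ / z) with z by (field; exact Hz).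
match goal with |- ?u = ?v => change (@eq C u v) end; unfold Cdiv; ring.
Qed.

Lemma joukowski_inj (z w : C) :
  z <> 0 -> w <> 0 -> (z + / z) / 2 = (w + / w) / 2 -> w = z \/ w = / z.
Proof.
intros Hz Hw H.
assert (H2 : RtoC 2 <> 0) by (intros E; apply RtoC_inj in E; lra).
assert (E : (w - z) * (z * w - 1) = 0).
{ replace ((w - z) * (z * w - 1))
    with (2 * z * w * ((w + / w) / 2 - (z + / z) / 2)) by (field; auto).
  rewrite H; ring. }
destruct (Ceq_dec (w - z) 0) as [E1|E1].
- left; replace w with ((w - z) + z) by ring; rewrite E1; ring.
- right; destruct (Ceq_dec (z * w - 1) 0) as [E2|E2].
  + replace w with (((z * w - 1) + 1) / z) by (field; auto).
    rewrite E2; field; auto.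
  + exfalso; exact (Cmult_neq_0 _ _ E1 E2 E).
Qed.

Lemma cdHahnE (n : nat) (z a b c p : C) :
  z <> 0 -> cdHahn n ((z + / z) / 2) a b c p = cdHahn_z n z a b c p.
Proof.
intros Hz; unfold cdHahn.
apply (@iota_unique C_AbsRing C_CompleteNormedModule).
- intros w Hw; apply Hw; auto.
- intros w Hw E; destruct (joukowski_inj z w Hz Hw E) as [->| ->]; auto.
  symmetry; apply cdHahn_z_inv; auto.
Qed.

(* Main.v *)
Require Import Defs.
From Stdlib Require Import Reals Lra Lia.
From Coquelicot Require Import Coquelicot.
Open Scope C_scope.

(** The asymptotics come from an exact formula.  Each factor of base [1/q] is
rewritten to the base [q] by
[1 - A q^(-j) = - A q^(-j) (1 - q^j / A)], and the defining sum becomes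
[[
  p_n(x;a,b,c|1/q) = q^(-2 binom(n,2)) (abc)^n (1/(ab), 1/(ac); q)_n
                     * sum_(k <= n) (q;q)_n / (q;q)_(n-k) * t_k
]]
where [t_k] are the terms of the 2phi2 series ([cdHahn_z_base_inv]).

It remains to compare the two products [(1/(ab);q)_n], [(1/(ac);q)_n] and the
sum with their limits.  With [r = |q|]:
- [(A;q)_n] differs from its limit by [O(r^n)], since consecutive partial
  products differ by [O(r^n)] ([qpoch_inf_geometric]);
- [(q;q)_n / (q;q)_(n-k) = 1 + O(r^(n-k))], uniformly in [n] and [k]
  ([falling_ratio_near_1]);
- [t_k] decreases faster than every geometric sequence, because of the factor
  [q^binom(k,2)] ([phi22_term_decay]); in particular [t_k = O(r^(2k))], and
  then the sum over [k] of [r^(n-k) |t_k|] is [O(r^n)]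
  ([falling_sum_geometric]).

The product of these three quantities has an error [O(r^n)] ([geometric_cv_mult]), which is
stronger than the [O(1/n)] claimed. *)

(** * Shifted factorials and inversion of the base *)

Lemma binom2_S (k : nat) : binom2 (S k) = (binom2 k + k)%nat.
Proof.
unfold binom2.
replace (S k * (S k - 1))%nat with (k * (k - 1) + k * 2)%nat
  by (destruct k as [|k]; simpl; [reflexivity | nia]).
apply Nat.div_add; discriminate.
Qed.

Lemma qpoch_add (A p : C) (k m : nat) :
  qpoch A p (k + m) = qpoch A p k * qpoch (A * p ^ k) p m.
Proof.
induction m as [|m IH].
- rewrite Nat.add_0_r; simpl; ring.
- rewrite Nat.add_succ_r; simpl; rewrite IH, Cpow_add_r; ring.
Qed.

Lemma qpoch_S_l (A p : C) (n : nat) :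
  qpoch A p (S n) = (1 - A) * qpoch (A * p) p n.
Proof.
change (S n) with (1 + n)%nat; rewrite qpoch_add, Cpow_1_r; simpl; ring.
Qed.

(** A zero [A] of the factor [1 - A q^j] is [q^(-j)], an element of [Omega q]. *)
Lemma qpoch_neq_0 (A q : C) (n : nat) :
  q <> 0 -> ~ Omega q A -> qpoch A q n <> 0.
Proof.
intros Hq HA; induction n as [|n IH]; simpl.
- exact C1_nz.
- apply Cmult_neq_0; [exact IH|]; intros E; apply HA; exists n.
  assert (Hn := Cpow_nz q n Hq).
  replace A with ((1 - (1 - A * q ^ n)) / q ^ n) by (field; exact Hn).
  rewrite E; field; exact Hn.
Qed.

Lemma Omega_base (q : C) : (Cmod q < 1)%R -> q <> 0 -> ~ Omega q q.
Proof.
intros Hr Hq [k E].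
assert (E1 : q ^ S k = 1).
{ rewrite Cpow_S; rewrite E at 1; field; apply Cpow_nz, Hq. }
apply (f_equal Cmod) in E1; rewrite Cmod_pow, Cmod_1 in E1.
assert (H := pow_lt_1_compat (Cmod q) (S k) (conj (Cmod_ge_0 q) Hr)
               (Nat.lt_0_succ k)); lra.
Qed.

(** The same factors [1 - q^j], [m < j <= m + k], taken in decreasing and in
increasing order of [j].  This disposes of the factor [(p^(-n);p)_k] of the
polynomials at [p = 1/q]. *)
Lemma qpoch_rev (q : C) (m k : nat) :
  q <> 0 -> qpoch (q ^ (m + k)) (/ q) k = qpoch (q ^ S m) q k.
Proof.
intros Hq; revert m; induction k as [|k IH]; intros m; [reflexivity|].
rewrite (qpoch_S_l (q ^ S m)), (Cmult_comm _ q), <- Cpow_S, <- IH.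
replace (S m + k)%nat with (m + S k)%nat by lia; simpl qpoch.
replace (q ^ (m + S k) * (/ q) ^ k) with (q ^ S m); [ring|].
rewrite Cpow_inv by exact Hq.
replace (m + S k)%nat with (S m + k)%nat by lia.
rewrite Cpow_add_r; field; apply Cpow_nz, Hq.
Qed.

(** Inverting the base of a single symbol yields the sign [(-1)^k]; in the
polynomials the symbols with parameters depending on [a], [b], [c], [z] come in
pairs, and for a pair the signs cancel. *)
Lemma qpoch_inv_pair (A B q : C) (k : nat) :
  q <> 0 -> A <> 0 -> B <> 0 ->
  qpoch A (/ q) k * qpoch B (/ q) k
  = qpoch (/ A) q k * qpoch (/ B) q k * (A * B) ^ k / q ^ (2 * binom2 k).
Proof.
intros Hq HA HB; induction k as [|k IH].
- simpl; field.
- rewrite binom2_S.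
  replace (2 * (binom2 k + k))%nat with (2 * binom2 k + k + k)%nat by lia.
  rewrite !Cpow_add_r.
  transitivity (qpoch A (/ q) k * qpoch B (/ q) k
                * ((1 - A * (/ q) ^ k) * (1 - B * (/ q) ^ k)));
    [simpl; ring|].
  rewrite IH, Cpow_inv by exact Hq; simpl; field.
  repeat split; try apply Cpow_nz; assumption.
Qed.

Lemma qpoch_inv_base (q : C) (k : nat) :
  q <> 0 ->
  qpoch (/ q) (/ q) k = (-1) ^ k * qpoch q q k / (q ^ binom2 k * q ^ k).
Proof.
intros Hq; induction k as [|k IH].
- simpl; field.
- rewrite binom2_S, Cpow_add_r; simpl.
  rewrite IH, Cpow_inv by exact Hq; field.
  repeat split; try apply Cpow_nz; exact Hq.
Qed.

(** This is [(q;q)_n / (q;q)_(n-k)] for [k <= n], written as a product so that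
its closeness to [1] is a property of a symbol with small parameter. *)
Definition falling_ratio (q : C) (n k : nat) : C := qpoch (q ^ S (n - k)) q k.

(** The symbols [(ab p^k;p)_(n-k)] and [(ac p^k;p)_(n-k)] are handled as
quotients of symbols of lengths [n] and [k]: the first gives the prefactor and
the second the denominator parameters of the 2phi2.  Their denominators do not
vanish because [1/(ab)] and [1/(ac)] lie outside [Omega q]. *)
Lemma cdHahn_term_base_inv (q a b c z : C) (n k : nat) :
  q <> 0 -> ~ Omega q q ->
  a <> 0 -> b <> 0 -> c <> 0 -> z <> 0 ->
  ~ Omega q (1 / (a * b)) -> ~ Omega q (1 / (a * c)) -> (k <= n)%nat ->
  (qpoch (/ (/ q) ^ n) (/ q) k * qpoch (a * z) (/ q) k
     * qpoch (a * / z) (/ q) k)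
  * (qpoch (a * b * (/ q) ^ k) (/ q) (n - k)
     * qpoch (a * c * (/ q) ^ k) (/ q) (n - k))
  / qpoch (/ q) (/ q) k * (/ q) ^ k
  = (a * a * (b * c)) ^ n / q ^ (2 * binom2 n)
    * (qpoch (1 / (a * b)) q n * qpoch (1 / (a * c)) q n)
    * (falling_ratio q n k
       * phi22_term (z / a) (1 / (a * z)) (1 / (a * b)) (1 / (a * c)) q
           (1 / (b * c)) k).
Proof.
intros Hq HO Ha Hb Hc Hz HB HC Hkn.
assert (Hab := Cmult_neq_0 a b Ha Hb).
assert (Hac := Cmult_neq_0 a c Ha Hc).
assert (Hbc := Cmult_neq_0 b c Hb Hc).
assert (Haz := Cmult_neq_0 a z Ha Hz).
assert (Hm : RtoC (-1) <> 0) by (intros X; apply RtoC_inj in X; lra).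
assert (Hza : a * / z <> 0).
{ intros E; apply Ha; replace a with (a * / z * z) by (field; exact Hz).
  rewrite E; ring. }
rewrite Cpow_inv by exact Hq.
replace (/ / q ^ n) with (q ^ n) by (field; apply Cpow_nz, Hq).
unfold falling_ratio, phi22_term.
set (B := 1 / (a * b)) in *; set (D := 1 / (a * c)) in *.
assert (EB : / (a * b) = B) by (unfold B; field; auto).
assert (ED : / (a * c) = D) by (unfold D; field; auto).
assert (HBk : qpoch B q k <> 0) by (apply qpoch_neq_0; assumption).
assert (HDk : qpoch D q k <> 0) by (apply qpoch_neq_0; assumption).
assert (Hqk : qpoch q q k <> 0) by (apply qpoch_neq_0; assumption).
assert (P1 := qpoch_inv_pair (a * z) (a * / z) q k Hq Haz Hza).
assert (P2 := qpoch_inv_pair (a * b) (a * c) q k Hq Hab Hac).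
assert (P3 := qpoch_inv_pair (a * b) (a * c) q n Hq Hab Hac).
rewrite EB, ED in P2, P3.
replace (/ (a * z)) with (1 / (a * z)) in P1 by (field; auto).
replace (/ (a * / z)) with (z / a) in P1 by (field; auto).
replace (a * z * (a * / z)) with (a * a) in P1 by (field; auto).
replace (a * b * (a * c)) with (a * a * (b * c)) in P2, P3 by ring.
(* The only sign left over comes from [(p;p)_k]; it appears inverted on one
   side and not on the other. *)
assert (Hsgn : (-1) ^ k * (-1) ^ k = 1).
{ rewrite <- Cpow_mult_l; replace (-1 * -1) with (RtoC 1) by ring.
  apply Cpow_1_l. }
rewrite (Cpow_mult_l (a * a) (b * c)) in P2.
rewrite (qpoch_inv_base q k Hq).
(* [P3] is split at [k], so that it expresses [X * Y], the symbols of length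
   [n - k], once [P2] is inserted. *)
replace n with (k + (n - k))%nat in P3 at 1 2 by lia.
rewrite !qpoch_add in P3.
replace (qpoch (q ^ n) (/ q) k) with (qpoch (q ^ S (n - k)) q k)
  by (rewrite <- qpoch_rev by exact Hq; f_equal; f_equal; lia).
replace (1 / (b * c)) with (/ (b * c)) by (field; auto).
rewrite (Cpow_inv (b * c)) by exact Hbc.
replace (2 * binom2 k)%nat with (binom2 k + binom2 k)%nat in P1, P2 by lia.
rewrite Cpow_add_r in P1, P2.
assert (Q1 := Cpow_nz q (binom2 k) Hq).
assert (Q2 := Cpow_nz q (2 * binom2 n) Hq).
assert (Q3 := Cpow_nz q k Hq).
assert (Q4 := Cpow_nz (-1) k Hm).
assert (Q5 := Cpow_nz (b * c) k Hbc).
assert (Q6 := Cpow_nz (a * a) k (Cmult_neq_0 a a Ha Ha)).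
rewrite Cpow_inv by exact Hq.
rewrite Cpow_inv in P3 by exact Hq.
set (X := qpoch (a * b * / q ^ k) (/ q) (n - k)) in *.
set (Y := qpoch (a * c * / q ^ k) (/ q) (n - k)) in *.
replace (qpoch (q ^ S (n - k)) q k * qpoch (a * z) (/ q) k * qpoch (a * / z) (/ q) k)
 with (qpoch (q ^ S (n - k)) q k * (qpoch (a * z) (/ q) k * qpoch (a * / z) (/ q) k)) by ring.
rewrite P1.
replace (qpoch (a * b) (/ q) k * X * (qpoch (a * c) (/ q) k * Y))
 with (qpoch (a * b) (/ q) k * qpoch (a * c) (/ q) k * (X * Y)) in P3 by ring.
rewrite P2 in P3.
set (XY := X * Y) in *.
generalize dependent XY; intros XY P3.
set (F := (a * a * (b * c)) ^ n) in *.
replace (F / q ^ (2 * binom2 n) * (qpoch B q n * qpoch D q n))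
 with (qpoch B q n * qpoch D q n * F / q ^ (2 * binom2 n)) by (field; exact Q2).
rewrite <- P3.
set (s := (-1) ^ k) in *.
assert (Es : / s = s) by (rewrite <- (Cmult_1_r (/ s)), <- Hsgn; field; exact Q4).
transitivity ((qpoch (q ^ S (n - k)) q k * qpoch (1 / (a * z)) q k * qpoch (z / a) q k * XY
   * (a * a) ^ k / (q ^ binom2 k * qpoch q q k)) * / s).
- field; repeat split; assumption.
- rewrite Es; field; repeat split; assumption.
Qed.

Lemma cdHahn_z_base_inv (q a b c z : C) (n : nat) :
  q <> 0 -> ~ Omega q q ->
  a <> 0 -> b <> 0 -> c <> 0 -> z <> 0 ->
  ~ Omega q (1 / (a * b)) -> ~ Omega q (1 / (a * c)) ->
  cdHahn_z n z a b c (/ q)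
  = / q ^ (2 * binom2 n) * (a * b * c) ^ n
    * (qpoch (1 / (a * b)) q n * qpoch (1 / (a * c)) q n
       * @sum_n C_AbelianMonoid (fun k => falling_ratio q n k
         * phi22_term (z / a) (1 / (a * z)) (1 / (a * b)) (1 / (a * c)) q
             (1 / (b * c)) k) n).
Proof.
intros Hq HO Ha Hb Hc Hz HB HC; unfold cdHahn_z.
erewrite sum_n_ext_loc
  by (intros k Hk; apply (cdHahn_term_base_inv q a b c z n k); assumption).
match goal with |- context [fun k : nat => ?M * (@?f k)] =>
  set (S1 := @sum_n C_AbelianMonoid (fun k => M * f k) n);
  assert (E : S1 = M * @sum_n C_AbelianMonoid f n)
    by exact (@sum_n_mult_l C_Ring M f n)
end.
rewrite E.
replace (a * a * (b * c)) with (a * (a * b * c)) by ring.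
rewrite Cpow_mult_l; field; split; apply Cpow_nz; assumption.
Qed.

(** * Convergence at a geometric rate *)

Lemma pow_0_1_bounds (r : R) (n : nat) : (0 < r < 1)%R -> (0 <= r ^ n <= 1)%R.
Proof.
intros Hr; split; [apply pow_le; lra|].
rewrite <- (pow1 n); apply pow_incr; lra.
Qed.

(** Summing the increments; the bound is uniform in [m], which gives at once the
Cauchy property, the rate of convergence, and for [n = 0] the distance to the
first term. *)
Lemma geometric_step_bound (s : nat -> C) (K r : R) :
  (0 < r < 1)%R ->
  (forall k, Cmod (s (S k) - s k) <= K * r ^ k)%R ->
  forall n m, (Cmod (s (n + m)%nat - s n) <= K / (1 - r) * r ^ n)%R.
Proof.
intros Hr Hs n m.
assert (HK : (0 <= K)%R).
{ specialize (Hs O); simpl in Hs; assert (H := Cmod_ge_0 (s 1%nat - s O)); lra. }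
apply Rle_trans with (K * r ^ n * ((1 - r ^ m) / (1 - r)))%R.
- induction m as [|m IH].
  + rewrite Nat.add_0_r; replace (s n - s n) with (RtoC 0) by ring.
    rewrite Cmod_0; simpl; right; field; lra.
  + rewrite Nat.add_succ_r.
    replace (s (S (n + m)) - s n)
      with ((s (S (n + m)) - s (n + m)%nat) + (s (n + m)%nat - s n)) by ring.
    eapply Rle_trans; [apply Cmod_triangle|].
    eapply Rle_trans; [apply Rplus_le_compat; [apply Hs | exact IH]|].
    rewrite pow_add; simpl; right; field; lra.
- assert (Hn := pow_0_1_bounds r n Hr); assert (Hm := pow_0_1_bounds r m Hr).
  replace (K / (1 - r) * r ^ n)%R with (K * r ^ n * (1 / (1 - r)))%R
    by (field; lra).
  apply Rmult_le_compat_l; [nra|].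
  apply Rmult_le_compat_r; [left; apply Rinv_0_lt_compat; lra | lra].
Qed.

Definition geometric_cv (r : R) (s : nat -> C) (l : C) : Prop :=
  exists K : R, forall n, (Cmod (s n - l) <= K * r ^ n)%R.

Lemma geometric_steps_converge (s : nat -> C) (K r : R) :
  (0 < r < 1)%R ->
  (forall k, Cmod (s (S k) - s k) <= K * r ^ k)%R ->
  exists l : C,
    filterlim s eventually (@locally C_UniformSpace l) /\ geometric_cv r s l.
Proof.
intros Hr Hs.
assert (Hb := geometric_step_bound s K r Hr Hs).
assert (HK : (0 <= K)%R).
{ specialize (Hs O); simpl in Hs; assert (H := Cmod_ge_0 (s 1%nat - s O)); lra. }
assert (HL : (0 <= K / (1 - r))%R)
  by (apply Rmult_le_pos; [exact HK | left; apply Rinv_0_lt_compat; lra]).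
set (L := (K / (1 - r))%R) in *.
assert (Hc : exists l : C_CompleteNormedModule,
               filterlim s eventually (@locally C_CompleteNormedModule l)).
{ apply (proj1 (@filterlim_locally_cauchy nat C_CompleteNormedModule eventually _ s)).
  intros eps.
  destruct (pow_lt_1_zero r) with (y := (eps / (L + 1))%R) as [N HN].
  - rewrite Rabs_pos_eq; lra.
  - apply Rdiv_lt_0_compat; [apply cond_pos | lra].
  - exists (fun u => (N <= u)%nat); split; [exists N; auto|].
    assert (Haux : forall u m, (N <= u)%nat -> (Cmod (s (u + m)%nat - s u) < eps)%R).
    { intros u m Hu; eapply Rle_lt_trans; [apply Hb|].
      specialize (HN u Hu); rewrite Rabs_pos_eq in HN by (apply pow_le; lra).
      apply Rle_lt_trans with ((L + 1) * r ^ u)%R.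
      - assert (H := pow_0_1_bounds r u Hr); nra.
      - replace (pos eps) with ((L + 1) * (eps / (L + 1)))%R by (field; lra).
        apply Rmult_lt_compat_l; [lra | exact HN]. }
    intros u v Hu Hv; apply (@norm_compat1 C_AbsRing C_NormedModule).
    change (Cmod (s v - s u) < eps)%R.
    destruct (Nat.le_ge_cases u v) as [H|H].
    + replace v with (u + (v - u))%nat by lia; apply Haux, Hu.
    + replace u with (v + (u - v))%nat by lia.
      rewrite <- Cmod_opp.
      replace (- (s v - s (v + (u - v))%nat)) with (s (v + (u - v))%nat - s v) by ring.
      apply Haux, Hv. }
destruct Hc as [l Hl]; exists l; split; [exact Hl|].
exists L; intros n.
apply le_epsilon; intros eps Heps.
(* The bound on [s (n + N) - s n] passes to the limit as [N] grows. *)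
assert (Hl' := proj1 (filterlim_locally_ball_norm (K := C_AbsRing) (U := C_NormedModule) s l) Hl (mkposreal eps Heps)).
destruct Hl' as [N HN].
specialize (HN (n + N)%nat ltac:(lia)).
change (Cmod (s (n + N)%nat - l) < eps)%R in HN.
specialize (Hb n N).
replace (s n - l) with (- (s (n + N)%nat - s n) + (s (n + N)%nat - l)) by ring.
eapply Rle_trans; [apply Cmod_triangle|].
rewrite Cmod_opp; lra.
Qed.

(** The product of the two errors is [O(r^(2n))], hence [O(r^n)]. *)
Lemma geometric_cv_mult (r : R) (s t : nat -> C) (l m : C) :
  (0 < r < 1)%R -> geometric_cv r s l -> geometric_cv r t m ->
  geometric_cv r (fun n => s n * t n) (l * m).
Proof.
intros Hr [K HK] [L HL].
exists (K * L + K * Cmod m + Cmod l * L)%R; intros n.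
replace (s n * t n - l * m)
  with ((s n - l) * (t n - m) + (s n - l) * m + l * (t n - m)) by ring.
specialize (HK n); specialize (HL n).
assert (Hn := pow_0_1_bounds r n Hr).
assert (H1 := Cmod_ge_0 (s n - l)); assert (H2 := Cmod_ge_0 (t n - m)).
assert (H3 := Cmod_ge_0 l); assert (H4 := Cmod_ge_0 m).
assert (E1 := Rmult_le_compat _ _ _ _ H1 H2 HK HL).
assert (E2 := Rmult_le_compat_r _ _ _ H4 HK).
assert (E3 := Rmult_le_compat_l _ _ _ H3 HL).
assert (E4 : (K * r ^ n * (L * r ^ n) <= K * L * r ^ n)%R).
{ assert (Hp : (0 < r ^ n)%R) by (apply pow_lt; lra).
  assert (HK0 : (0 <= K)%R) by (apply (Rmult_le_reg_r (r ^ n)); lra).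
  assert (HL0 : (0 <= L)%R) by (apply (Rmult_le_reg_r (r ^ n)); lra).
  replace (K * r ^ n * (L * r ^ n))%R with (K * L * (r ^ n * r ^ n))%R by ring.
  apply Rmult_le_compat_l; [apply Rmult_le_pos; assumption | nra]. }
eapply Rle_trans; [apply Cmod_triangle|].
rewrite Cmod_mult with (x := l).
eapply Rle_trans; [apply Rplus_le_compat_r, Cmod_triangle|].
rewrite !Cmod_mult; lra.
Qed.

(** Bernoulli's inequality [1 + n h <= (1 + h)^n] with [1 + h = 1/r]. *)
Lemma geometric_le_inv_INR (r : R) (n : nat) :
  (0 < r < 1)%R -> (0 < n)%nat -> (r ^ n <= r / (1 - r) / INR n)%R.
Proof.
intros Hr Hn.
assert (HN : (0 < INR n)%R) by (apply lt_0_INR, Hn).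
set (h := (/ r - 1)%R).
assert (Hh : (0 < h)%R).
{ unfold h; assert (1 < / r)%R; [|lra].
  rewrite <- Rinv_1; apply Rinv_lt_contravar; lra. }
assert (HB := poly n h Hh).
replace (1 + h)%R with (/ r)%R in HB by (unfold h; ring).
rewrite pow_inv in HB.
assert (Hp : (0 < r ^ n)%R) by (apply pow_lt; lra).
replace (r / (1 - r) / INR n)%R with (/ (INR n * h))%R
  by (unfold h; field; repeat split; lra).
rewrite <- (Rinv_inv (r ^ n)).
apply Rinv_le_contravar; [apply Rmult_lt_0_compat; assumption | lra].
Qed.

(** * Convergence of the infinite products *)

(** [prod (1 + rho r^j) <= exp (rho * sum r^j)].  The bound depends on [A] only
through [rho], as is needed where [A] is a power of [q] that varies with
[n - k]. *)
Lemma qpoch_bounded (q A : C) (rho : R) (n : nat) :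
  (0 < Cmod q < 1)%R -> (Cmod A <= rho)%R ->
  (Cmod (qpoch A q n) <= exp (rho / (1 - Cmod q)))%R.
Proof.
intros Hr HA; set (r := Cmod q) in *.
assert (H0 := Cmod_ge_0 A).
apply Rle_trans with (exp (rho * ((1 - r ^ n) / (1 - r)))).
- induction n as [|n IH]; simpl qpoch.
  + rewrite Cmod_1; simpl; rewrite <- exp_0 at 1; right; f_equal; field; lra.
  + rewrite Cmod_mult.
    replace (rho * ((1 - r ^ S n) / (1 - r)))%R
      with (rho * ((1 - r ^ n) / (1 - r)) + rho * r ^ n)%R
      by (simpl; field; lra).
    rewrite exp_plus.
    apply Rmult_le_compat; try apply Cmod_ge_0; [exact IH|].
    eapply Rle_trans; [apply Cmod_triangle|].
    rewrite Cmod_1, Cmod_opp, Cmod_mult, Cmod_pow; fold r.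
    eapply Rle_trans; [|apply exp_ineq1_le].
    apply Rplus_le_compat_l, Rmult_le_compat_r; [apply pow_le; lra | exact HA].
- assert (Hn := pow_0_1_bounds r n Hr).
  assert (H : (rho * ((1 - r ^ n) / (1 - r)) <= rho / (1 - r))%R).
  { apply Rmult_le_compat_l; [lra|].
    rewrite <- (Rmult_1_l (/ (1 - r))).
    apply Rmult_le_compat_r; [left; apply Rinv_0_lt_compat; lra | lra]. }
  destruct H as [H|H]; [left; apply exp_increasing, H | right; f_equal; exact H].
Qed.

Lemma qpoch_step (q A : C) (rho : R) (k : nat) :
  (0 < Cmod q < 1)%R -> (Cmod A <= rho)%R ->
  (Cmod (qpoch A q (S k) - qpoch A q k)
   <= exp (rho / (1 - Cmod q)) * Cmod A * Cmod q ^ k)%R.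
Proof.
intros Hr HA; simpl qpoch.
replace (qpoch A q k * (1 - A * q ^ k) - qpoch A q k)
  with (- (qpoch A q k * (A * q ^ k))) by ring.
rewrite Cmod_opp, !Cmod_mult, Cmod_pow, Rmult_assoc.
apply Rmult_le_compat_r.
- apply Rmult_le_pos; [apply Cmod_ge_0 | apply pow_le; lra].
- apply qpoch_bounded; assumption.
Qed.

Lemma qpoch_inf_geometric (q A : C) :
  (0 < Cmod q < 1)%R -> geometric_cv (Cmod q) (qpoch A q) (qpoch_inf A q).
Proof.
intros Hr.
destruct (geometric_steps_converge (qpoch A q) _ (Cmod q) Hr
            (fun k => qpoch_step q A (Cmod A) k Hr (Rle_refl _))) as [l [Hl Hg]].
replace (qpoch_inf A q) with l; [exact Hg|].
symmetry; unfold qpoch_inf.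
apply (@iota_filterlim_locally C_AbsRing C_CompleteNormedModule nat eventually _ (qpoch A q) l Hl).
Qed.

(** The ratio is [(A;q)_k] with [A = q^(n-k+1)], whose distance to
[1 = (A;q)_0] is at most a constant times [|A|]; as [|A| <= 1], the constant does
not depend on [n] and [k]. *)
Lemma falling_ratio_near_1 (q : C) :
  (0 < Cmod q < 1)%R ->
  exists M : R, (0 <= M)%R /\ forall n k : nat,
    (Cmod (falling_ratio q n k - 1) <= M * Cmod q ^ (n - k))%R.
Proof.
intros Hr; set (r := Cmod q) in *.
set (M := (exp (1 / (1 - r)) / (1 - r))%R).
assert (HM : (0 <= M)%R).
{ apply Rmult_le_pos; left; [apply exp_pos | apply Rinv_0_lt_compat; lra]. }
exists M; split; [exact HM|]; intros n k.
unfold falling_ratio; set (A := q ^ S (n - k)).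
assert (HA : Cmod A = (r ^ S (n - k))%R) by apply Cmod_pow.
assert (HA1 : (Cmod A <= 1)%R) by (rewrite HA; apply pow_0_1_bounds, Hr).
assert (H := geometric_step_bound (qpoch A q) _ r Hr
               (fun j => qpoch_step q A 1 j Hr HA1) 0 k).
simpl in H; fold r in H.
eapply Rle_trans; [exact H|].
replace (exp (1 / (1 - r)) * Cmod A / (1 - r) * 1)%R with (M * Cmod A)%R
  by (unfold M; field; lra).
apply Rmult_le_compat_l; [exact HM|].
rewrite HA; simpl; assert (Hn := pow_0_1_bounds r (n - k) Hr); nra.
Qed.

(** * The basic hypergeometric series *)

(** The factors are non-zero and tend to [1]: from some [N] on they are at least
[1/2] in modulus, and only finitely many remain. *)
Lemma qfactor_bounded_below (q B : C) :
  (0 < Cmod q < 1)%R -> ~ Omega q B ->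
  exists d : R, (0 < d)%R /\ forall k, (d <= Cmod (1 - B * q ^ k))%R.
Proof.
intros Hr HB; set (r := Cmod q) in *.
assert (Hq : q <> 0) by (apply Cmod_gt_0; fold r; lra).
assert (Hnz : forall k, (0 < Cmod (1 - B * q ^ k))%R).
{ intros k; apply Cmod_gt_0; intros E.
  apply (qpoch_neq_0 B q (S k) Hq HB); simpl; rewrite E; ring. }
assert (Hfin : forall N, exists d : R, (0 < d)%R /\
          forall k, (k < N)%nat -> (d <= Cmod (1 - B * q ^ k))%R).
{ induction N as [|N [d [Hd IH]]].
  - exists 1%R; split; [lra | intros k Hk; lia].
  - exists (Rmin d (Cmod (1 - B * q ^ N))); split.
    + apply Rmin_glb_lt; [exact Hd | apply Hnz].
    + intros k Hk; destruct (Nat.eq_dec k N) as [->|Hne]; [apply Rmin_r|].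
      eapply Rle_trans; [apply Rmin_l | apply IH; lia]. }
assert (H0 := Cmod_ge_0 B).
destruct (pow_lt_1_zero r) with (y := (/ (2 * (Cmod B + 1)))%R) as [N HN].
- rewrite Rabs_pos_eq; lra.
- apply Rinv_0_lt_compat; lra.
- destruct (Hfin N) as [d [Hd IH]].
  exists (Rmin d (1 / 2)); split; [apply Rmin_glb_lt; lra|]; intros k.
  destruct (Nat.lt_ge_cases k N) as [Hk|Hk].
  + eapply Rle_trans; [apply Rmin_l | apply IH, Hk].
  + eapply Rle_trans; [apply Rmin_r|].
    specialize (HN k Hk); rewrite Rabs_pos_eq in HN by (apply pow_le; lra).
    assert (H1 := Cmod_triangle (1 - B * q ^ k) (B * q ^ k)).
    replace (1 - B * q ^ k + B * q ^ k) with (RtoC 1) in H1 by ring.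
    rewrite Cmod_1, (Cmod_mult B), Cmod_pow in H1; fold r in H1.
    assert (H2 : (Cmod B * r ^ k <= 1 / 2)%R); [|lra].
    assert (Hk0 : (0 <= r ^ k)%R) by (apply pow_le; lra).
    apply Rle_trans with ((Cmod B + 1) * r ^ k)%R; [nra|].
    replace (1 / 2)%R with ((Cmod B + 1) * / (2 * (Cmod B + 1)))%R
      by (field; lra).
    apply Rmult_le_compat_l; lra.
Qed.

(** The ratio of consecutive terms tends to [0], so it is eventually below
[rho]; the constant absorbs the finitely many terms before that. *)
Lemma superexponential_decay (u : nat -> R) (L r rho : R) :
  (0 < r < 1)%R -> (0 < rho)%R -> (0 <= L)%R -> (forall k, 0 <= u k)%R ->
  (forall k, u (S k) <= L * r ^ k * u k)%R ->
  exists K : R, (0 <= K)%R /\ forall k, (u k <= K * rho ^ k)%R.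
Proof.
intros Hr Hrho HL Hu Hstep.
assert (Hfin : forall N, exists K : R, (0 <= K)%R /\
          forall k, (k <= N)%nat -> (u k <= K * rho ^ k)%R).
{ induction N as [|N [K [HK IH]]].
  - exists (u O); split; [apply Hu|]; intros k Hk.
    replace k with O by lia; simpl; lra.
  - assert (Hp : (0 < rho ^ S N)%R) by (apply pow_lt, Hrho).
    exists (Rmax K (u (S N) / rho ^ S N)); split.
    + eapply Rle_trans; [exact HK | apply Rmax_l].
    + intros k Hk; destruct (Nat.eq_dec k (S N)) as [->|Hne].
      * apply Rle_trans with (u (S N) / rho ^ S N * rho ^ S N)%R;
          [right; field; lra|].
        apply Rmult_le_compat_r; [lra | apply Rmax_r].
      * eapply Rle_trans; [apply IH; lia|].
        apply Rmult_le_compat_r; [apply pow_le; lra | apply Rmax_l]. }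
destruct (pow_lt_1_zero r) with (y := (rho / (L + 1))%R) as [N HN].
- rewrite Rabs_pos_eq; lra.
- apply Rdiv_lt_0_compat; lra.
- destruct (Hfin N) as [K [HK IH]]; exists K; split; [exact HK|].
  induction k as [|k IHk]; [apply IH; lia|].
  destruct (Nat.le_gt_cases (S k) N) as [Hk|Hk]; [apply IH, Hk|].
  assert (HNk := HN k ltac:(lia)).
  rewrite Rabs_pos_eq in HNk by (apply pow_le; lra).
  assert (Hrk : (0 <= r ^ k)%R) by (apply pow_le; lra).
  assert (HLr : (L * r ^ k <= rho)%R).
  { apply Rle_trans with ((L + 1) * r ^ k)%R; [nra|].
    replace rho with ((L + 1) * (rho / (L + 1)))%R at 1 by (field; lra).
    apply Rmult_le_compat_l; lra. }
  eapply Rle_trans; [apply Hstep|].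
  replace (K * rho ^ S k)%R with (rho * (K * rho ^ k))%R by (simpl; ring).
  apply Rmult_le_compat; auto; nra.
Qed.

Lemma Cmod_one_minus_le (q A : C) (k : nat) :
  (0 < Cmod q < 1)%R -> (Cmod (1 - A * q ^ k) <= 1 + Cmod A)%R.
Proof.
intros Hr; eapply Rle_trans; [apply Cmod_triangle|].
rewrite Cmod_1, Cmod_opp, Cmod_mult, Cmod_pow.
assert (Hk := pow_0_1_bounds _ k Hr); assert (H0 := Cmod_ge_0 A); nra.
Qed.

(** The ratio [t_(k+1) / t_k] is [q^k] times a quotient that is bounded in [k],
the denominators being bounded away from [0]. *)
Lemma phi22_term_decay (q a1 a2 b1 b2 w : C) (rho : R) :
  (0 < Cmod q < 1)%R -> ~ Omega q b1 -> ~ Omega q b2 -> (0 < rho)%R ->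
  exists K : R, (0 <= K)%R /\
    forall k, (Cmod (phi22_term a1 a2 b1 b2 q w k) <= K * rho ^ k)%R.
Proof.
intros Hr Hb1 Hb2 Hrho.
assert (Hq : q <> 0) by (apply Cmod_gt_0; lra).
assert (HO : ~ Omega q q) by (apply Omega_base; [lra | exact Hq]).
destruct (qfactor_bounded_below q q Hr HO) as [d0 [Hd0 L0]].
destruct (qfactor_bounded_below q b1 Hr Hb1) as [d1 [Hd1 L1]].
destruct (qfactor_bounded_below q b2 Hr Hb2) as [d2 [Hd2 L2]].
set (L := ((1 + Cmod a1) * (1 + Cmod a2) * Cmod w * / (d0 * d1 * d2))%R).
assert (Hd : (0 < d0 * d1 * d2)%R) by (repeat apply Rmult_lt_0_compat; assumption).
assert (A1 := Cmod_ge_0 a1); assert (A2 := Cmod_ge_0 a2);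
assert (A3 := Cmod_ge_0 w).
assert (Hnum : (0 <= (1 + Cmod a1) * (1 + Cmod a2) * Cmod w)%R)
  by (repeat apply Rmult_le_pos; lra).
apply (superexponential_decay _ L (Cmod q)); auto.
- apply Rmult_le_pos; [exact Hnum | left; apply Rinv_0_lt_compat, Hd].
- intros k; apply Cmod_ge_0.
- intros k.
  assert (F0 : 1 - q * q ^ k <> 0) by (apply Cmod_gt_0; specialize (L0 k); lra).
  assert (F1 : 1 - b1 * q ^ k <> 0) by (apply Cmod_gt_0; specialize (L1 k); lra).
  assert (F2 : 1 - b2 * q ^ k <> 0) by (apply Cmod_gt_0; specialize (L2 k); lra).
  assert (E : phi22_term a1 a2 b1 b2 q w (S k)
    = - (((1 - a1 * q ^ k) * (1 - a2 * q ^ k) * w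
        / ((1 - q * q ^ k) * (1 - b1 * q ^ k) * (1 - b2 * q ^ k)))
      * q ^ k * phi22_term a1 a2 b1 b2 q w k)).
  { unfold phi22_term; rewrite binom2_S, Cpow_add_r; simpl; field.
    repeat split; try assumption; apply qpoch_neq_0; assumption. }
  rewrite E, Cmod_opp, !Cmod_mult, Cmod_pow.
  apply Rmult_le_compat_r; [apply Cmod_ge_0|].
  apply Rmult_le_compat_r; [apply pow_le; lra|].
  rewrite Cmod_div by (repeat apply Cmult_neq_0; assumption); unfold Rdiv.
  rewrite !Cmod_mult.
  assert (B0 := L0 k); assert (B1 := L1 k); assert (B2 := L2 k).
  apply Rmult_le_compat.
  + repeat apply Rmult_le_pos; apply Cmod_ge_0.
  + left; apply Rinv_0_lt_compat; repeat apply Rmult_lt_0_compat; lra.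
  + apply Rmult_le_compat_r; [exact A3|].
    apply Rmult_le_compat; try apply Cmod_ge_0; apply Cmod_one_minus_le, Hr.
  + apply Rinv_le_contravar; [exact Hd|].
    apply Rmult_le_compat; try lra; [nra|].
    apply Rmult_le_compat; lra.
Qed.

Lemma sum_n_S_C (f : nat -> C) (n : nat) :
  @sum_n C_AbelianMonoid f (S n) = @sum_n C_AbelianMonoid f n + f (S n).
Proof. exact (@sum_Sn C_AbelianMonoid f n). Qed.

Lemma Cmod_sum_n_le_geometric (f : nat -> C) (K r : R) (n : nat) :
  (0 < r < 1)%R -> (0 <= K)%R ->
  (forall k, (k <= n)%nat -> Cmod (f k) <= K * r ^ k)%R ->
  (Cmod (@sum_n C_AbelianMonoid f n) <= K / (1 - r))%R.
Proof.
intros Hr HK Hf.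
apply Rle_trans with (K * ((1 - r ^ S n) / (1 - r)))%R.
- induction n as [|n IH].
  + rewrite sum_O; eapply Rle_trans; [apply Hf; lia|].
    simpl; right; field; lra.
  + rewrite sum_n_S_C; eapply Rle_trans; [apply Cmod_triangle|].
    eapply Rle_trans.
    * apply Rplus_le_compat; [apply IH; intros k Hk; apply Hf; lia | apply Hf; lia].
    * simpl; right; field; lra.
- assert (Hn := pow_0_1_bounds r (S n) Hr).
  apply Rmult_le_compat_l; [exact HK|].
  rewrite <- (Rmult_1_l (/ (1 - r))).
  apply Rmult_le_compat_r; [left; apply Rinv_0_lt_compat; lra | lra].
Qed.

Lemma phi22_geometric (q a1 a2 b1 b2 w : C) :
  (0 < Cmod q < 1)%R -> ~ Omega q b1 -> ~ Omega q b2 ->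
  geometric_cv (Cmod q)
    (@sum_n C_AbelianMonoid (phi22_term a1 a2 b1 b2 q w))
    (phi22 a1 a2 b1 b2 q w).
Proof.
intros Hr Hb1 Hb2; set (t := phi22_term a1 a2 b1 b2 q w).
destruct (phi22_term_decay q a1 a2 b1 b2 w (Cmod q) Hr Hb1 Hb2 (proj1 Hr))
  as [K [HK Ht]].
destruct (geometric_steps_converge (@sum_n C_AbelianMonoid t) K (Cmod q) Hr)
  as [l [Hl Hg]].
{ intros k; rewrite sum_n_S_C.
  match goal with |- (Cmod ?e <= _)%R => replace e with (t (S k)) by ring end.
  eapply Rle_trans; [apply Ht|].
  simpl; assert (Hk := pow_0_1_bounds _ k Hr).
  apply Rmult_le_compat_l; [exact HK | nra]. }
replace (phi22 a1 a2 b1 b2 q w) with l; [exact Hg|].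
symmetry; unfold phi22.
apply (@iota_filterlim_locally C_AbsRing C_CompleteNormedModule nat eventually _
         (@sum_n C_AbelianMonoid t) l Hl).
Qed.

(** Replacing the ratios by [1] costs at most
[sum_(k <= n) M r^(n-k) |t_k|].  The decay [|t_k| <= K r^(2k)] turns the summand
into [M K r^n r^k], so that one factor [r^k] makes up for the poor closeness of
the ratio to [1] when [k] is near [n], and the other makes the sum converge. *)
Lemma falling_sum_geometric (q a1 a2 b1 b2 w : C) :
  (0 < Cmod q < 1)%R -> ~ Omega q b1 -> ~ Omega q b2 ->
  geometric_cv (Cmod q)
    (fun n => @sum_n C_AbelianMonoid
       (fun k => falling_ratio q n k * phi22_term a1 a2 b1 b2 q w k) n)
    (phi22 a1 a2 b1 b2 q w).
Proof.
intros Hr Hb1 Hb2; set (t := phi22_term a1 a2 b1 b2 q w); set (r := Cmod q) in *.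
destruct (phi22_geometric q a1 a2 b1 b2 w Hr Hb1 Hb2) as [L HL].
fold t r in HL.
destruct (falling_ratio_near_1 q Hr) as [M [HM Hd]]; fold r in Hd.
assert (Hrr : (0 < r * r)%R) by nra.
destruct (phi22_term_decay q a1 a2 b1 b2 w (r * r) Hr Hb1 Hb2 Hrr)
  as [K [HK Ht]]; fold t in Ht.
exists (M * K / (1 - r) + L)%R; intros n.
set (s := @sum_n C_AbelianMonoid (fun k => falling_ratio q n k * t k) n).
assert (E : s - @sum_n C_AbelianMonoid t n
            = @sum_n C_AbelianMonoid (fun k => (falling_ratio q n k - 1) * t k) n).
{ assert (G : forall (d : nat -> C) N,
    @sum_n C_AbelianMonoid (fun k => d k * t k) N - @sum_n C_AbelianMonoid t N
    = @sum_n C_AbelianMonoid (fun k => (d k - 1) * t k) N).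
  { intros d; induction N as [|N IH].
    - rewrite !sum_O; match goal with |- ?u = ?v => change (@eq C u v) end; ring.
    - rewrite !sum_n_S_C, <- IH; ring. }
  apply G. }
replace (s - phi22 a1 a2 b1 b2 q w)
  with ((s - @sum_n C_AbelianMonoid t n)
        + (@sum_n C_AbelianMonoid t n - phi22 a1 a2 b1 b2 q w)) by ring.
eapply Rle_trans; [apply Cmod_triangle|].
rewrite Rmult_plus_distr_r; apply Rplus_le_compat; [|apply HL].
rewrite E; assert (Hn := pow_0_1_bounds r n Hr).
replace (M * K / (1 - r) * r ^ n)%R with (M * K * r ^ n / (1 - r))%R
  by (field; lra).
apply Cmod_sum_n_le_geometric; [exact Hr | repeat apply Rmult_le_pos; lra|].
intros k Hk; rewrite Cmod_mult.
apply Rle_trans with (M * r ^ (n - k) * (K * (r * r) ^ k))%R.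
- apply Rmult_le_compat; try apply Cmod_ge_0; [apply Hd | apply Ht].
- replace n with (n - k + k)%nat at 2 by lia.
  rewrite pow_add, Rpow_mult_distr; right; ring.
Qed.

Theorem lemma4p6 :
  forall q a b c z x : C,
  (0 < Cmod q < 1)%R ->
  a <> 0 -> b <> 0 -> c <> 0 -> z <> 0 ->
  ~ Omega q (1 / (a * b)) -> ~ Omega q (1 / (a * c)) ->
  x = (z + / z) / 2 ->
  exists K : R, eventually (fun n : nat =>
    (Cmod (cdHahn n x a b c (/ q)
           - / q ^ (2 * binom2 n) * (a * b * c) ^ n
             * (qpoch_inf (1 / (a * b)) q * qpoch_inf (1 / (a * c)) q)
             * phi22 (z / a) (1 / (a * z)) (1 / (a * b)) (1 / (a * c)) q
                     (1 / (b * c)))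
     <= K * (/ Cmod q ^ (2 * binom2 n) * Cmod (a * b * c) ^ n / INR n))%R).
Proof.
intros q a b c z x Hr Ha Hb Hc Hz HB HC ->.
assert (Hq : q <> 0) by (apply Cmod_gt_0; lra).
assert (HO : ~ Omega q q) by (apply Omega_base; [lra | exact Hq]).
destruct (geometric_cv_mult _ _ _ _ _ Hr
  (geometric_cv_mult _ _ _ _ _ Hr
     (qpoch_inf_geometric q (1 / (a * b)) Hr)
     (qpoch_inf_geometric q (1 / (a * c)) Hr))
  (falling_sum_geometric q (z / a) (1 / (a * z)) (1 / (a * b)) (1 / (a * c))
     (1 / (b * c)) Hr HB HC)) as [K HK].
set (r := Cmod q) in *.
exists (K * (r / (1 - r)))%R; exists 1%nat; intros n Hn.
specialize (HK n).
rewrite cdHahnE, cdHahn_z_base_inv by assumption.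
match goal with |- (Cmod (?P * ?X - ?P * ?Y * ?Z) <= _)%R =>
  replace (P * X - P * Y * Z) with (P * (X - Y * Z)) by ring end.
rewrite !Cmod_mult, Cmod_inv, !Cmod_pow by (apply Cpow_nz, Hq); fold r.
rewrite !Cmod_mult.
assert (HK0 : (0 <= K)%R).
{ assert (Hp : (0 < r ^ n)%R) by (apply pow_lt; lra).
  eapply Rmult_le_reg_r; [exact Hp|]; rewrite Rmult_0_l.
  eapply Rle_trans; [apply Cmod_ge_0 | exact HK]. }
(* The error relative to the prefactor is [K r^n], and [r^n = O(1/n)]. *)
assert (Hg := geometric_le_inv_INR r n Hr ltac:(lia)).
match goal with |- (?P * _ <= _)%R => set (p := P) end.
assert (Hp : (0 <= p)%R).
{ apply Rmult_le_pos; [left; apply Rinv_0_lt_compat, pow_lt; lra|].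
  apply pow_le; repeat apply Rmult_le_pos; apply Cmod_ge_0. }
replace (K * (r / (1 - r)) * (p / INR n))%R
  with (p * (K * (r / (1 - r) / INR n)))%R
  by (unfold Rdiv; ring).
apply Rmult_le_compat_l; [exact Hp|].
eapply Rle_trans; [exact HK|].
apply Rmult_le_compat_l; assumption.
Qed.
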